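(* Let $G$ be an undirected multigraph with unit edge weights on a vertex set $V$ with $|V|=n$, whose $m$ edges arrive as a stream $e_1,e_2,\dots,e_m$ in arbitrary (possibly adversarial) order. Let $d>0$ be a constant and let $\epsilon>0$ be sufficiently small. Run the algorithm Stream-Sparsification (described in the context) with parameter $$\rho=\frac{32\big((4+d)\ln n+\ln m\big)(1+\epsilon)}{\epsilon^2}.$$ Then, with probability $1-O(1/n^d)$, the output $H$ satisfies $H\in(1\pm\epsilon)G$, i.e. for every cut $C$ of $V$, $(1-\epsilon)\,VAL(C,G)\le VAL(C,H)\le(1+\epsilon)\,VAL(C,G)$.
   Context: A cut $C$ is a partition of $V$ into two nonempty parts; for a weighted graph $K$ on $V$, $VAL(C,K)$ is the total weight of the edges of $K$ crossing $C$. For weighted graphs $K,K'$ on $V$, $K'\in(1\pm\epsilon)K$ means $(1-\epsilon)VAL(C,K)\le VAL(C,K')\le(1+\epsilon)VAL(C,K)$ for every cut $C$. A weighted graph is $k$-strongly connected if every cut of it has value at least $k$. A $k$-strong connected component of a weighted graph is a maximal vertex-induced subgraph that is $k$-strongly connected. The strong connectivity of an edge $e=\{u,v\}$ in a weighted graph $K$ is the maximum $k$ such that some $k$-strong connected component of $K$ contains both $u$ and $v$ (this is $0$ if no positive $k$ works). Algorithm Stream-Sparsification with parameter $\rho>0$: start with $H=(V,\emptyset)$. For $i=1,\dots,m$: let $c_{e_i}$ be the strong connectivity of $e_i$ in the current $H$; set $p_{e_i}=\min\{\rho/c_{e_i},1\}$ (with $p_{e_i}=1$ if $c_{e_i}=0$);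 with probability $p_{e_i}$, using fresh independent randomness, add $e_i$ to $H$ with weight $1/p_{e_i}$. The output is the final $H$. *)

(* Defs.v *)
From HB Require Import structures.
From mathcomp Require Import all_boot all_order all_algebra.
From mathcomp Require Import reals exp.

Set Implicit Arguments.
Unset Strict Implicit.
Unset Printing Implicit Defensive.

Import Order.TTheory GRing.Theory Num.Theory.
Local Open Scope ring_scope.

(* An undirected edge {u, v} is written (u, v); every definition below is
   invariant under swapping the two endpoints. *)
Definition edge (V : finType) : Type := (V * V)%type.

(* Parallel edges are repeated entries. *)
Definition wgraph (R : realType) (V : finType) : Type := seq (edge V * R).

Definition unit_graph (R : realType) (V : finType) (s : seq (edge V)) :
    wgraph R V :=
  [seq (e, 1) | e <- s].

(* A encodes the partition {A, W \ A} of the vertex set W. *)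
Definition is_cut (V : finType) (W A : {set V}) : bool :=
  (A != set0) && (A \proper W).

Definition crosses (V : finType) (A : {set V}) (e : edge V) : bool :=
  (e.1 \in A) != (e.2 \in A).

Definition VAL (R : realType) (V : finType) (A : {set V}) (K : wgraph R V) : R :=
  \sum_(x <- K | crosses A x.1) x.2.

Definition approximates (R : realType) (V : finType) (eps : R)
    (K K' : wgraph R V) : bool :=
  [forall A : {set V}, is_cut [set: V] A ==>
    ((1 - eps) * VAL A K <= VAL A K' <= (1 + eps) * VAL A K)].

Definition induced (R : realType) (V : finType) (K : wgraph R V) (W : {set V}) :
    wgraph R V :=
  [seq x <- K | (x.1.1 \in W) && (x.1.2 \in W)].

Definition strongly_connected (R : realType) (V : finType) (K : wgraph R V)
    (k : R) (W : {set V}) : bool :=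
  [forall A : {set V}, is_cut W A ==> (k <= VAL A (induced K W))].

Definition strong_component (R : realType) (V : finType) (K : wgraph R V)
    (k : R) (W : {set V}) : bool :=
  maxset (strongly_connected K k) W.

(* For e.1 != e.2 the supremum is a maximum as soon as some positive k
   qualifies; otherwise the set is empty and [sup] returns 0. *)
Definition strong_connectivity (R : realType) (V : finType) (K : wgraph R V)
    (e : edge V) : R :=
  sup (fun k : R => 0 < k /\
    exists W : {set V}, [/\ strong_component K k W, e.1 \in W & e.2 \in W]).

(* Finitely supported distributions, as lists of (probability, outcome). *)
Definition dist (R : realType) (T : Type) : Type := seq (R * T).

Definition dret (R : realType) (T : Type) (x : T) : dist R T := [:: (1, x)].

Definition dbind (R : realType) (T U : Type) (D : dist R T)
    (f : T -> dist R U) : dist R U :=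
  flatten [seq [seq (a.1 * b.1, b.2) | b <- f a.2] | a <- D].

Definition flip (R : realType) (p : R) : dist R bool :=
  [:: (p, true); (1 - p, false)].

Definition Pr (R : realType) (T : Type) (D : dist R T) (E : pred T) : R :=
  \sum_(a <- D | E a.2) a.1.

Definition sampling_prob (R : realType) (V : finType) (rho : R)
    (H : wgraph R V) (e : edge V) : R :=
  let c := strong_connectivity H e in
  if c == 0 then 1 else Num.min (rho / c) 1.

Definition sparsification_step (R : realType) (V : finType) (rho : R)
    (H : wgraph R V) (e : edge V) : dist R (wgraph R V) :=
  let p := sampling_prob rho H e in
  dbind (flip p) (fun b => dret R (if b then rcons H (e, p^-1) else H)).

Definition stream_sparsification (R : realType) (V : finType) (rho : R)
    (s : seq (edge V)) : dist R (wgraph R V) :=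
  foldl (fun D e => dbind D (fun H => sparsification_step rho H e))
    (dret R [::]) s.

(* Main.v *)
(* For a cut the error of H is a martingale whose increments are controlled by
   the strong connectivities used for sampling, so everything rests on showing
   that these never exceed (1 + eps) times the strengths in the graph streamed so
   far.  The strength k of an arriving edge is witnessed by a chain of at most n
   vertex sets, each split by at most k edges of strength at most k, one of which
   splits any given vertex set containing the edge; a Chernoff bound for these n
   cuts bounds the strong connectivity in H by (1 + eps) k.  Killing the process
   at the first violation makes the bound available at all later steps.

   For the final graph, an edge of strength k is written as k copies of weight
   1 / k, one in each of the levels 1, ..., k.  At level j the graph splits into
   its j-strong components, in which all cuts have weight at least 1 for the
   weights 1 / strength.  A cut of weight w fails with probability at most
   exp (- 8 w X), where X = (4 + d) ln n + ln m, and Karger's bound on the number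
   of cuts of weight w allows a union bound over the cuts of each component. *)
Require Import Defs.
From mathcomp Require Import all_boot all_order all_algebra.
From mathcomp Require Import boolp reals sequences exp.
From mathcomp Require Import ring lra.
Import Order.TTheory GRing.Theory Num.Theory.
Local Open Scope ring_scope.
Set Implicit Arguments.
Unset Strict Implicit.

(** Squaring [1 - y / 2 <= expR (- (y / 2))] gives [expR y <= (1 - y / 2)^-2]. The rest is
    polynomial: [(1 + y + y^2) (1 - y / 2)^2 - 1] equals [y^2 (1 - 3 y + y^2) / 4]. *)
Lemma expR_le_quadratic (R : realType) (y : R) :
  - 1 <= y -> y <= 3^-1 -> expR y <= 1 + y + y ^+ 2.
Proof.
move=> y_ge y_le.
have half_gt0 : 0 < 1 - y / 2 by lra.
have exp_half : 1 - y / 2 <= expR (- (y / 2)) by apply: expR_ge1Dx.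
have -> : y = y / 2 + y / 2 by lra.
rewrite expRD -[X in X * X]invrK -expRN -invfM.
apply: (@le_trans _ _ ((1 - y / 2) ^+ 2)^-1).
  rewrite lef_pV2 ?posrE ?mulr_gt0 ?exprn_gt0 ?expR_gt0 //.
  by rewrite expr2 ler_pM // ltW.
rewrite -splitr -[leLHS]mul1r ler_pdivrMr ?exprn_gt0 //.
have : 0 <= y ^+ 2 * (1 - 3 * y + y ^+ 2) by rewrite mulr_ge0 ?sqr_ge0 //; nra.
nra.
Qed.

Definition inside (V : finType) (W : {set V}) (e : edge V) : bool :=
  (e.1 \in W) && (e.2 \in W).

(** * Cut counting *)

Section CutCounting.
Variables (R : realType) (V : finType).
Implicit Types (K : wgraph R V) (S A B : {set V}).

Lemma is_cut_setI S A x y :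
  x \in S -> y \in S -> x \in A -> y \notin A -> is_cut S (S :&: A).
Proof.
move=> xS yS xA yA; apply/andP; split.
  by apply/set0Pn; exists x; rewrite inE xS.
apply/properP; split; first exact: subsetIl.
by exists y; rewrite // inE yS.
Qed.

Lemma card_cut S A : is_cut S A -> (1 < #|S|)%N.
Proof.
case/andP=> /set0Pn[x xA] /proper_card; apply: leq_ltn_trans.
by rewrite card_gt0; apply/set0Pn; exists x.
Qed.

(** Contraction leaves loops behind, which cross no cut, so the total weight from which an edge is
    drawn must omit them. *)
Definition nonloop_weight K : R := \sum_(x <- K | x.1.1 != x.1.2) x.2.

Lemma VAL_nonloop K A :
  \sum_(x <- K | (x.1.1 != x.1.2) && ~~ crosses A x.1) x.2 =
  nonloop_weight K - VAL A K.
Proof.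
apply/eqP; rewrite eq_sym subr_eq addrC; apply/eqP.
rewrite /nonloop_weight (bigID (fun x => crosses A x.1)) /=; congr (_ + _).
apply: eq_bigl => x; rewrite andbC andb_idr // /crosses.
by apply: contra => /eqP ->.
Qed.

(** Handshake identity: a non-loop edge counts at both of its ends, a loop at none. *)
Lemma degree_sum K S : all (fun x => inside S x.1) K ->
  \sum_(z in S) VAL [set z] K = 2 * nonloop_weight K.
Proof.
move=> /allP KS; rewrite /VAL.
under eq_bigr do rewrite big_mkcond.
rewrite exchange_big /= mulr_sumr /nonloop_weight.
rewrite [RHS]big_mkcond big_seq [RHS]big_seq.
apply: eq_bigr => -[[u v] w] /KS /andP[/= uS vS].
have E z : crosses [set z] (u, v) = ((z == u) != (z == v)).
  by rewrite /crosses /= !inE ![_ == z]eq_sym.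
under eq_bigr do rewrite E.
case: eqVneq => [<-|nuv]; first by rewrite big1 // => z _; rewrite eqxx.
rewrite (bigD1 u) //= eqxx nuv (bigD1 v) /=; last by rewrite vS eq_sym.
rewrite eqxx (eq_sym v u) (negPf nuv) /= big1 ?addr0; first by ring.
by move=> z /andP[/andP[_ /negPf->] /negPf->].
Qed.

Definition contract (u v : V) K : wgraph R V :=
  let r z := if z == v then u else z in
  [seq ((r x.1.1, r x.1.2), x.2) | x <- K].

Lemma VAL_contract (u v : V) K B : v \notin B ->
  VAL B (contract u v K) = VAL (if u \in B then v |: B else B) K.
Proof.
move=> vB; rewrite /VAL big_map; apply: eq_bigl => -[[x y] w].
have E z : ((if z == v then u else z) \in B) =
           (z \in (if u \in B then v |: B else B)).
  case: eqVneq => [->|nzv]; case: ifP => //; rewrite ?inE ?eqxx //.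
    by rewrite (negPf vB).
  by rewrite (negPf nzv).
by rewrite /crosses /= !E.
Qed.

Lemma is_cutD1_notin S B v : is_cut (S :\ v) B -> v \notin B.
Proof.
case/andP=> _ /proper_sub /subsetP BS; apply/negP => /BS.
by rewrite !inE eqxx.
Qed.

Lemma is_cut_uncontract S B u v : u \in S -> v \in S -> u != v -> v \notin B ->
  is_cut S (if u \in B then v |: B else B) = is_cut (S :\ v) B.
Proof.
move=> uS vS nuv vB; apply/idP/idP.
  case/andP=> n0 /properP[sub [y yS yB]]; apply/andP; split.
    by case: ifP n0 => // uB _; apply/set0Pn; exists u.
  apply/properP; split.
    apply/subsetP => z zB; rewrite !inE; apply/andP; split.
      by apply: contraNneq vB => <-.
    by apply: (subsetP sub); case: ifP; rewrite ?inE ?zB ?orbT.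
  case: ifP sub yB => uB sub yB.
    by exists y; move: yB; rewrite !inE negb_or => /andP[? ?] //; apply/andP.
  by exists u; rewrite ?inE ?nuv ?uB.
case/andP=> n0 /properP[sub [y yS yB]]; apply/andP; split.
  have /set0Pn[z zB] := n0.
  by apply/set0Pn; exists z; case: ifP; rewrite ?inE ?zB ?orbT.
move: yS; rewrite !inE => /andP[nyv yS].
apply/properP; split; last first.
  by exists y => //; case: ifP => _ //; rewrite !inE negb_or nyv.
have BS : B \subset S by apply: subset_trans sub (subD1set _ _).
by case: ifP => // _; rewrite subUset sub1set vS.
Qed.

(** A side that does not separate [u] from [v] is recovered from its trace on [S :\ v]: [v] follows
    [u]. *)
Lemma sum_uncrossed (F : {set V} -> R) S (u v : V) :
  u \in S -> v \in S -> u != v ->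
  \sum_(A | is_cut S A && ~~ crosses A (u, v)) F A =
  \sum_(B | is_cut (S :\ v) B) F (if u \in B then v |: B else B).
Proof.
move=> uS vS nuv.
rewrite (reindex_onto (fun B => if u \in B then v |: B else B)
  (fun A => A :\ v)) /=; last first.
  move=> A /andP[_]; rewrite /crosses /= negbK => /eqP uvA.
  rewrite !inE nuv /= uvA; case: ifP => vA; first by rewrite setD1K.
  by apply/setDidPl; rewrite disjoint_sym disjoints1 vA.
apply: eq_bigl => B.
have [vB|vB] := boolP (v \in B).
  rewrite [RHS](contraTF (@is_cutD1_notin S B v)) //.
  by apply/negbTE/negP => /andP[_ /eqP E]; move: vB; rewrite -E !inE eqxx.
rewrite is_cut_uncontract //.
have -> : ((if u \in B then v |: B else B) :\ v == B).
  apply/eqP; case: ifP => _; first by rewrite setU1K.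
  by apply/setDidPl; rewrite disjoint_sym disjoints1.
have -> : ~~ crosses (if u \in B then v |: B else B) (u, v).
  by rewrite /crosses negbK /=; case: ifP => uB;
    rewrite ?inE ?uB ?eqxx ?(negPf vB) ?orbT.
by rewrite !andbT.
Qed.

(** Inductive step of the cut count for one cut of weight [w]: [(W - w) / W] is its chance to
    survive a contraction, and the last term is an allowance per subset. If [4 * w] exceeds [q.+1],
    the allowance alone suffices. Otherwise put [y = w / q.+1 <= 1/4]; passing from [q] to [q.+1]
    gains a factor at most [expR (- (4 * y)) <= 1 - 2 * y <= 1 - w / W]. *)
Lemma cut_exp_step (q : nat) (w W : R) : (0 < q)%N -> 0 <= w -> w <= W ->
  q.+1%:R <= 2 * W ->
  expR (- (4 * w * ln q.+1%:R)) <=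
  (W - w) / W * expR (- (4 * w * ln q%:R)) + (2^-1) ^+ q.+1.
Proof.
move=> q0 w0 wW qW.
have q0R : 0 < q%:R :> R by rewrite ltr0n.
have Q0 : 0 < q.+1%:R :> R by rewrite ltr0n.
have W0 : 0 < W by nra.
have [small|big] := leP (4 * w) q.+1%:R; last first.
  apply: ler_wpDl.
    by rewrite mulr_ge0 ?expR_ge0 // divr_ge0 ?subr_ge0 // ltW.
  have -> : 2^-1 = expR (- ln 2) :> R by rewrite expRN lnK // posrE.
  rewrite -expRM_natl ler_expR mulrN lerN2.
  apply: ler_pM; rewrite ?ler0n ?ln_ge0 ?ler1n //; first exact: ltW.
  by rewrite ler_ln ?posrE // ler_nat.
apply: ler_wpDr; first by rewrite exprn_ge0 // invr_ge0.
have lnq : q.+1%:R^-1 <= ln q.+1%:R - ln q%:R :> R.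
  rewrite -lerN2 opprB -ln_div ?posrE //.
  have -> : q%:R / q.+1%:R = 1 + (- q.+1%:R^-1) :> R.
    have -> : q%:R = q.+1%:R - 1 :> R by rewrite -natr1 addrK.
    by rewrite mulrBl divff ?gt_eqF // mul1r.
  by apply: le_ln1Dx; rewrite ltrN2 invf_lt1 // ltr1n.
set y := w / q.+1%:R.
have y0 : 0 <= y by rewrite divr_ge0 // ltW.
have y4 : y <= 4^-1 by rewrite /y ler_pdivrMr //; lra.
apply: (@le_trans _ _ (expR (- (4 * y)) * expR (- (4 * w * ln q%:R)))).
  rewrite -expRD ler_expR -opprD lerN2 -mulrA -mulrA -mulrDr ler_pM2l //.
  by rewrite /y -mulrDr ler_wpM2l // -lerBrDr.
apply: ler_wpM2r; first exact: expR_ge0.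
apply: (@le_trans _ _ (1 - 2 * y)).
  rewrite expRN -[leLHS]mul1r ler_pdivrMr ?expR_gt0 //.
  have := expR_ge1Dx (4 * y); nra.
rewrite mulrBl divff ?gt_eqF // lerD2l lerN2.
rewrite ler_pdivrMr // /y.
have -> : 2 * (w / q.+1%:R) * W = w * ((2 * W) / q.+1%:R) by ring.
by rewrite ler_peMr // ler_pdivlMr // mul1r.
Qed.

(* Karger's cut counting, with the weak exponent [4] in exchange for a short
   induction: contract an edge chosen with probability proportional to its
   weight; a cut of weight [w] survives with probability
   [1 - w / W >= 1 - 2 w / #|S|]. *)
Lemma cut_counting K S :
  all (fun x => inside S x.1 && (0 <= x.2)) K ->
  (forall A, is_cut S A -> 1 <= VAL A K) ->
  \sum_(A | is_cut S A) expR (- (4 * VAL A K * ln #|S|%:R)) <= #|S|%:R.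
Proof.
have [q] := ubnP #|S|; elim: q S K => // q IH S K Sq Kok Kcut.
have [S1|S2] := leqP #|S| 1.
  rewrite big1 // => A /card_cut.
  by rewrite ltnNge S1.
have Kin : all (fun x => inside S x.1) K by apply: sub_all Kok => x /andP[].
have [p Sp] : exists p, #|S| = p.+1 by exists #|S|.-1; rewrite prednK // ltnW.
rewrite Sp in Sq S2 *.
have p0 : (0 < p)%N by [].
pose W := nonloop_weight K.
(* Singletons are cuts, so every vertex of [S] has degree at least 1. *)
have SW : p.+1%:R <= 2 * W.
  rewrite -(degree_sum Kin) -Sp -sum1_card natr_sum; apply: ler_sum => z zS.
  apply: Kcut; apply/andP; split; first by apply/set0Pn; exists z; rewrite inE.
  by rewrite properEcard sub1set zS cards1 Sp.
have W0 : 0 < W by have := lt_le_trans (ltr0Sn R p) SW; rewrite pmulr_rgt0.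
have K0 x : x \in K -> 0 <= x.2 by move=> /(allP Kok)/andP[].
have VW A : VAL A K <= W.
  rewrite -subr_ge0 -VAL_nonloop big_seq_cond sumr_ge0 // => x /andP[xK _].
  exact: K0.
have V0 A : 0 <= VAL A K.
  by rewrite /VAL big_seq_cond sumr_ge0 // => x /andP[/K0].
pose F A := expR (- (4 * VAL A K * ln p%:R)).
have uncrossed x : x \in K -> x.1.1 != x.1.2 ->
    \sum_(A | is_cut S A && ~~ crosses A x.1) F A <= p%:R.
  case: x => -[u v] w xK /= nuv.
  have /andP[/andP[/= uS vS] _] := allP Kok _ xK.
  have Sv : #|S :\ v| = p by move: Sp; rewrite (cardsD1 v) vS => -[].
  rewrite (sum_uncrossed F uS vS nuv) -[in X in _ <= X]Sv.
  have IHK := IH (S :\ v) (contract u v K).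
  apply: le_trans (IHK _ _ _) => {IHK}.
  - apply: ler_sum => B /is_cutD1_notin vB.
    by rewrite /F VAL_contract // Sv.
  - by rewrite Sv.
  - apply/allP => _ /mapP[y yK ->] /=.
    have /andP[/andP[y1 y2] ->] := allP Kok _ yK.
    have E z : z \in S -> (if z == v then u else z) \in S :\ v.
      by rewrite !inE; case: (eqVneq z v) => [_|-> ->] //; rewrite nuv.
    by rewrite andbT /inside /= !E.
  - move=> B cutB; have vB := is_cutD1_notin cutB.
    by rewrite VAL_contract // Kcut // is_cut_uncontract.
(* Average of [uncrossed] over an edge drawn proportionally to weight; the numerator [W - VAL A K]
   is the weight of the non-loop edges that [A] leaves uncrossed. *)
have avg : \sum_(A | is_cut S A) (W - VAL A K) / W * F A <= p%:R.
  under eq_bigr do rewrite mulrAC.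
  rewrite -mulr_suml ler_pdivrMr //.
  have -> : \sum_(A | is_cut S A) (W - VAL A K) * F A =
      \sum_(x <- K | x.1.1 != x.1.2)
        x.2 * \sum_(A | is_cut S A && ~~ crosses A x.1) F A.
    under eq_bigr do rewrite -VAL_nonloop mulr_suml.
    rewrite (exchange_big_dep (fun x => x.1.1 != x.1.2)) /=; last first.
      by move=> A x _ /andP[].
    apply: eq_bigr => x nx; rewrite mulr_sumr.
    by apply: eq_bigl => A; rewrite nx.
  rewrite mulrC /W /nonloop_weight mulr_suml big_seq_cond [leRHS]big_seq_cond.
  apply: ler_sum => x /andP[xK nx].
  by rewrite ler_wpM2l ?K0 // uncrossed.
apply: (@le_trans _ _ (\sum_(A | is_cut S A)
    ((W - VAL A K) / W * F A + 2^-1 ^+ p.+1))).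
  by apply: ler_sum => A cutA; apply: cut_exp_step.
rewrite big_split /= -(natr1 p) lerD // -Sp.
(* The allowances sum to at most 1 over all subsets of [S], which pays for the step from [p] to
   [p.+1]. *)
apply: (@le_trans _ _ (\sum_(A in powerset S) 2^-1 ^+ #|S|)).
  rewrite big_mkcond [leRHS]big_mkcond; apply: ler_sum => A _.
  rewrite inE; case: ifP => [/andP[_ /proper_sub ->] //|_].
  by case: ifP; rewrite // exprn_ge0 // invr_ge0.
by rewrite sumr_const card_powerset -[leLHS]mulr_natr natrX -exprMn mulVf
  ?pnatr_eq0 // expr1n.
Qed.
End CutCounting.

(** * Exponential moments of the sampling process *)

Section Sampling.
Variables (R : realType) (V : finType).
Implicit Types (H : wgraph R V) (e : edge V) (a : edge V -> R).

Definition wsum a H : R := \sum_(x <- H) a x.1 * x.2.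

Lemma wsum_rcons a H e w : wsum a (rcons H (e, w)) = wsum a H + a e * w.
Proof. by rewrite /wsum -cats1 big_cat big_seq1. Qed.

Lemma strong_connectivity_ge0 H e : 0 <= strong_connectivity H e.
Proof.
rewrite /strong_connectivity; set E := (fun k => _).
(* [sup] defaults to 0 where no supremum exists. *)
have [hs|/sup_out->//] := pselect (classical_sets.has_sup E).
have [[k Ek] _] := hs; have [k0 _] := Ek.
exact: le_trans (ltW k0) (sup_upper_bound hs Ek).
Qed.

Lemma strong_connectivity_le H e (c : R) : 0 <= c ->
  (forall k W, strongly_connected H k W -> inside W e -> k <= c) ->
  strong_connectivity H e <= c.
Proof.
move=> c0 le_c; rewrite /strong_connectivity; set E := (fun k => _).
have [[k Ek]|E0] := pselect (exists k, E k); last first.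
  by rewrite sup_out // => -[].
apply: ge_sup; first by exists k.
move=> j [_ [W [/maxsetp sW e1 e2]]]; apply: (le_c _ W) => //.
by rewrite /inside e1.
Qed.

Variable rho : R.
Hypothesis rho_gt0 : 0 < rho.

Lemma sampling_prob_gt0 H e : 0 < sampling_prob rho H e.
Proof.
rewrite /sampling_prob; case: eqVneq => // c0.
by rewrite lt_min ltr01 divr_gt0 // lt_def c0 strong_connectivity_ge0.
Qed.

Lemma sampling_prob_le1 H e : sampling_prob rho H e <= 1.
Proof.
by rewrite /sampling_prob; case: eqVneq => // _; rewrite ge_min lexx orbT.
Qed.

Lemma sampling_prob_lt1 H e : sampling_prob rho H e < 1 ->
  (sampling_prob rho H e)^-1 = strong_connectivity H e / rho.
Proof.
rewrite /sampling_prob; case: eqVneq => [|c0]; first by rewrite ltxx.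
by rewrite minElt; case: ifP => _; rewrite ?ltxx // invf_div.
Qed.

(** * Expectations of runs as recursions along the stream *)

Definition expect_step (f : wgraph R V -> R) H e : R :=
  let p := sampling_prob rho H e in p * f (rcons H (e, p^-1)) + (1 - p) * f H.

Fixpoint expect_run (s : seq (edge V)) (f : wgraph R V -> R) H : R :=
  if s is e :: s' then expect_step (expect_run s' f) H e else f H.

Definition expect (T : Type) (D : dist R T) (f : T -> R) : R :=
  \sum_(x <- D) x.1 * f x.2.

Lemma Pr_expect (T : Type) (D : dist R T) (P : pred T) :
  Pr D P = expect D (fun x => (P x)%:R).
Proof.
rewrite /Pr big_mkcond; apply: eq_bigr => x _.
by case: (P _); rewrite ?mulr1 ?mulr0.
Qed.

Lemma expect_dbind (T U : Type) (D : dist R T) (g : T -> dist R U) f :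
  expect (dbind D g) f = expect D (fun x => expect (g x) f).
Proof.
rewrite /expect /dbind big_flatten big_map; apply: eq_bigr => x _.
by rewrite big_map mulr_sumr; apply: eq_bigr => y _; rewrite /= mulrA.
Qed.

Lemma expect_sparsification_step H e f :
  expect (sparsification_step rho H e) f = expect_step f H e.
Proof.
rewrite /sparsification_step expect_dbind /expect /flip.
by rewrite !(big_cons, big_nil) /= !mul1r !addr0.
Qed.

Lemma expect_stream s f :
  expect (stream_sparsification rho s) f = expect_run s f [::].
Proof.
rewrite /stream_sparsification.
have -> : expect_run s f [::] = expect (dret R [::]) (expect_run s f).
  by rewrite /expect big_seq1 mul1r.
elim: s (dret _ _) => //= e s IH D; rewrite IH expect_dbind.
by apply: eq_bigr => x _; rewrite expect_sparsification_step.
Qed.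

Lemma expect_run_cst s c H : expect_run s (fun=> c) H = c.
Proof.
elim: s H => //= e s IH H.
by rewrite /expect_step !IH -mulrDl addrC subrK mul1r.
Qed.

Lemma expect_run_add s f g H :
  expect_run s (fun H => f H + g H) H = expect_run s f H + expect_run s g H.
Proof.
by elim: s H => //= e s IH H; rewrite /expect_step !IH; ring.
Qed.

Definition supported (E : pred (edge V)) H :=
  all (fun x => E x.1 && (0 <= x.2)) H.

Lemma supported_rcons (E : pred (edge V)) H e : E e -> supported E H ->
  supported E (rcons H (e, (sampling_prob rho H e)^-1)).
Proof.
move=> Ee suppH; rewrite /supported all_rcons /= Ee.
by rewrite invr_ge0 ltW ?sampling_prob_gt0.
Qed.

Lemma expect_step_le (f g : wgraph R V -> R) H e :
  f H <= g H ->
  f (rcons H (e, (sampling_prob rho H e)^-1)) <=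
  g (rcons H (e, (sampling_prob rho H e)^-1)) ->
  expect_step f H e <= expect_step g H e.
Proof.
move=> fg fg'; rewrite /expect_step lerD // ler_wpM2l //.
  exact/ltW/sampling_prob_gt0.
by rewrite subr_ge0 sampling_prob_le1.
Qed.

Lemma expect_run_le s f g H : (forall H, f H <= g H) ->
  expect_run s f H <= expect_run s g H.
Proof.
by move=> fg; elim: s H => //= e s IH H; apply: expect_step_le.
Qed.

(* Killing a run at the first edge whose strong connectivity exceeds the bound
   attached to it replaces conditioning on the history, which [H] does not
   determine. *)
Fixpoint expect_killed (t : seq (edge V * R)) (f : wgraph R V -> R) H : R :=
  if t is x :: t' then
    if strong_connectivity H x.1 <= x.2
    then expect_step (expect_killed t' f) H x.1 else 0
  else f H.

Lemma expect_killed_le (E : pred (edge V)) t f g H :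
  all (fun x => E x.1) t -> supported E H ->
  (forall H, supported E H -> f H <= g H) ->
  expect_killed t f H <= expect_killed t g H.
Proof.
move=> tE suppH fg; elim: t H tE suppH => [|x t IH] H /=; first by move=> _ /fg.
case/andP=> Ex tE suppH; case: ifP => // _.
by apply: expect_step_le; rewrite IH // supported_rcons.
Qed.

Lemma expect_killed_sum (I : Type) (r : seq I) (P : pred I)
    (F : I -> wgraph R V -> R) t H :
  expect_killed t (fun H => \sum_(i <- r | P i) F i H) H =
  \sum_(i <- r | P i) expect_killed t (F i) H.
Proof.
elim: t H => //= x t IH H; case: ifP => _; last by rewrite big1.
by rewrite /expect_step !IH !mulr_sumr -big_split.
Qed.

Lemma expect_killed_scale c f t H :
  expect_killed t (fun H => c * f H) H = c * expect_killed t f H.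
Proof.
elim: t H => //= x t IH H; case: ifP => _; last by rewrite mulr0.
by rewrite /expect_step !IH; ring.
Qed.

(** A run either passes every check or fails first at some index [i]; since [f <= 1], the latter
    costs at most the probability of surviving up to [i] and failing there. *)
Lemma expect_run_killed x0 t f H : (forall H, 0 <= f H <= 1) ->
  expect_run [seq x.1 | x <- t] f H <= expect_killed t f H +
    \sum_(i < size t) expect_killed (take i t)
      (fun H =>
        (~~ (strong_connectivity H (nth x0 t i).1 <= (nth x0 t i).2))%:R) H.
Proof.
move=> f01; elim: t H => [|x t IH] H /=; first by rewrite big_ord0 addr0.
pose g H := expect_killed t f H + \sum_(i < size t) expect_killed (take i t)
  (fun H => (~~ (strong_connectivity H (nth x0 t i).1 <= (nth x0 t i).2))%:R) H.
rewrite big_ord_recl /=; case: ifP => good; last first.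
  rewrite add0r big1 ?addr0; last by [].
  apply: (@le_trans _ _ (expect_run (x.1 :: map fst t) (fun=> 1) H)).
    by apply: (expect_run_le (x.1 :: map fst t)) => H'; case/andP: (f01 H').
  by rewrite expect_run_cst.
rewrite add0r.
apply: (le_trans (expect_step_le (g := g) (IH H) (IH _))).
rewrite /expect_step /g !mulrDr !mulr_sumr addrACA lerD // -big_split /=.
by apply: ler_sum.
Qed.

(** If [p = 1], the increment is exactly [a e]. If [p < 1], it is [b = a e / p] with probability
    [p], and [b <= M] because [p^-1] is the strong connectivity over [rho]; the quadratic bound
    applies, with second moment [p * b^2 <= M * a e]. The constant [w] carries the factor already
    extracted from later steps. *)
Lemma expect_step_mgf a theta (M w kappa : R) H e :
  0 <= M -> `|theta| * M <= 3^-1 ->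
  0 <= a e -> a e * kappa <= M * rho -> strong_connectivity H e <= kappa ->
  expect_step (fun H => expR (theta * wsum a H + w)) H e <=
  expR (theta * wsum a H + (theta + theta ^+ 2 * M) * a e + w).
Proof.
move=> M0 thM a0 aM sck; rewrite /expect_step /= wsum_rcons.
set p := sampling_prob rho H e.
have p0 : 0 < p := sampling_prob_gt0 H e.
set b := a e / p; set th := theta * wsum a H.
have -> : theta * (wsum a H + b) + w = (th + w) + theta * b by rewrite /th; ring.
have -> : th + (theta + theta ^+ 2 * M) * a e + w =
  (th + w) + (theta + theta ^+ 2 * M) * a e by ring.
rewrite !(expRD (th + w)).
set X := expR (th + w).
have -> : p * (X * expR (theta * b)) + (1 - p) * X =
  X * (1 + p * (expR (theta * b) - 1)) by ring.
apply: ler_wpM2l; first exact: expR_ge0.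
have aE : a e = p * b by rewrite /b mulrCA divff ?mulr1 // gt_eqF.
have [p1|] := ltP p 1; last first.
  move=> p1; have {}p1 : p = 1 by apply/le_anti; rewrite p1 sampling_prob_le1.
  rewrite p1 mul1r addrC subrK ler_expR /b p1 divr1 mulrDl lerDl.
  by apply: mulr_ge0 => //; apply: mulr_ge0; rewrite ?sqr_ge0.
have b0 : 0 <= b by rewrite divr_ge0 // ltW.
have bM : b <= M.
  rewrite /b sampling_prob_lt1 // mulrA ler_pdivrMr //.
  by apply: le_trans aM; rewrite ler_wpM2l.
have thb : `|theta * b| <= 3^-1.
  by rewrite normrM (ger0_norm b0); apply: le_trans thM; rewrite ler_wpM2l.
move: thb; rewrite ler_norml => /andP[thb1 thb2].
have := expR_le_quadratic _ thb2; rewrite exprMn => /(_ _) q.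
apply: le_trans (expR_ge1Dx _); rewrite lerD2l.
apply: (@le_trans _ _ (p * (theta * b + theta ^+ 2 * b ^+ 2))).
  rewrite ler_wpM2l //; first exact: ltW.
  rewrite lerBlDl addrA; apply: q; lra.
rewrite aE [leRHS]mulrCA; apply: ler_wpM2l; first exact: ltW.
by rewrite mulrDl lerD2l -[leRHS]mulrA ler_wpM2l ?sqr_ge0 // expr2 ler_wpM2r.
Qed.

Lemma expect_killed_mgf a theta (M : R) t H : 0 <= M -> `|theta| * M <= 3^-1 ->
  (forall x, x \in t -> 0 <= a x.1 /\ a x.1 * x.2 <= M * rho) ->
  expect_killed t (fun H => expR (theta * wsum a H)) H <=
  expR (theta * wsum a H + (theta + theta ^+ 2 * M) * \sum_(x <- t) a x.1).
Proof.
move=> M0 thM; elim: t H => [|x t IH] H at_ /=.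
  by rewrite big_nil mulr0 addr0.
case: ifP => [good|_]; last exact: expR_ge0.
have [a0 aM] := at_ x (mem_head _ _).
have {}IH H' := IH H' (fun y yt => at_ y (mem_behead (s := x :: t) yt)).
pose g H := expR (theta * wsum a H +
  (theta + theta ^+ 2 * M) * \sum_(x <- t) a x.1).
apply: (le_trans (expect_step_le (g := g) (IH H) (IH _))).
apply: le_trans (expect_step_mgf _ M0 thM a0 aM good) _.
by rewrite big_cons mulrDr addrA.
Qed.

(* Chernoff bound, with [theta = +- eps / (2 M)]. *)
Lemma expect_killed_tail a (M eps L S : R) (b : bool) t :
  0 < M -> 0 <= eps -> eps <= 2^-1 ->
  (forall x, x \in t -> 0 <= a x.1 /\ a x.1 * x.2 <= M * rho) ->
  \sum_(x <- t) a x.1 = S -> S <= L ->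
  expect_killed t (fun H => (eps * L < (-1) ^+ b * (wsum a H - S))%R%:R) [::]
  <= expR (- (eps ^+ 2 * L / (4 * M))).
Proof.
move=> M0 eps0 eps2 at_ SE sL.
pose th : R := (-1) ^+ b * (eps / (2 * M)).
have epsM0 : 0 <= eps / (2 * M) by rewrite divr_ge0 // mulr_ge0 // ltW.
have sgn2 : ((-1) ^+ b) ^+ 2 = 1 :> R by rewrite sqrr_sign.
have ndth : `|th| = eps / (2 * M).
  by rewrite normrM normrX normrN1 expr1n mul1r ger0_norm.
have th2 : th ^+ 2 = (eps / (2 * M)) ^+ 2 by rewrite exprMn sgn2 mul1r.
(* Markov's inequality: the indicator is at most the exponential of [eps / (2 * M)] times the excess
   over [eps * L], and [c] is the deterministic part of that exponential. *)
set c := expR (- (eps ^+ 2 * L / (2 * M)) - th * S).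
apply: (@le_trans _ _ (expect_killed t (fun H => c * expR (th * wsum a H)) [::])).
  apply: (@expect_killed_le predT) => //; first by elim: (t).
  move=> H _; rewrite /c -expRD.
  case: ltP => [big|_]; last exact: expR_ge0.
  rewrite -[leLHS]expR0 ler_expR.
  have -> : - (eps ^+ 2 * L / (2 * M)) - th * S + th * wsum a H =
     (eps / (2 * M)) * ((-1) ^+ b * (wsum a H - S) - eps * L).
    rewrite /th; ring.
  by apply: mulr_ge0 => //; rewrite subr_ge0 ltW.
rewrite expect_killed_scale.
apply: le_trans (ler_wpM2l (expR_ge0 _) (expect_killed_mgf [::] (ltW M0) _ at_)) _.
  rewrite ndth; have -> : eps / (2 * M) * M = eps / 2 by field; rewrite gt_eqF.
  lra.
rewrite /c -expRD ler_expR /wsum big_nil mulr0 add0r SE th2.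
have -> : - (eps ^+ 2 * L / (2 * M)) - th * S +
    (th + (eps / (2 * M)) ^+ 2 * M) * S =
    - (eps ^+ 2 * L / (2 * M)) + eps ^+ 2 / (4 * M) * S.
  by field; rewrite gt_eqF.
have -> : - (eps ^+ 2 * L / (4 * M)) =
    - (eps ^+ 2 * L / (2 * M)) + eps ^+ 2 / (4 * M) * L.
  by field; rewrite gt_eqF.
by rewrite lerD2l ler_wpM2l // divr_ge0 ?sqr_ge0 // mulr_ge0 // ltW.
Qed.

End Sampling.

(** * Strengths in a multigraph *)

Section Strength.
Variable V : finType.
Implicit Types (s : seq (edge V)) (e x : edge V) (W S U A C : {set V}).

Definition ncross s W A : nat := count (fun e => inside W e && crosses A e) s.

Definition kstrong s k W : bool :=
  [forall A : {set V}, is_cut W A ==> (k <= ncross s W A)%N].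

(** Strong connectivity in the unit-weight multigraph, as an integer. For a non-loop edge the cutoff
    at [size s] loses nothing, since no cut has more edges. *)
Definition strength s e : nat :=
  \max_(k < (size s).+1 | [exists W, kstrong s k W && inside W e]) k.

Lemma crosses_setI W A e : inside W e -> crosses (W :&: A) e = crosses A e.
Proof. by case/andP=> e1 e2; rewrite /crosses !inE e1 e2. Qed.

Lemma crossesP A e : reflect
  ((e.1 \in A /\ e.2 \notin A) \/ (e.1 \notin A /\ e.2 \in A)) (crosses A e).
Proof.
rewrite /crosses; case: (e.1 \in A); case: (e.2 \in A); constructor;
  by [left | right | case; case].
Qed.

Lemma kstrong_separated s k W A u v : kstrong s k W -> u \in W -> v \in W ->
  u \in A -> v \notin A -> (k <= ncross s W A)%N.
Proof.
move=> /forallP sW uW vW uA vA.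
have /implyP := sW (W :&: A); rewrite (is_cut_setI uW vW uA vA) => /(_ isT).
move/leq_trans; apply; apply: sub_count => e /andP[eW].
by rewrite (crosses_setI _ eW) eW.
Qed.

Lemma kstrong_crossed s k W A e :
  kstrong s k W -> inside W e -> crosses A e -> (k <= ncross s W A)%N.
Proof.
move=> sW /andP[e1 e2] /crossesP[[a1 a2]|[a1 a2]].
  exact: kstrong_separated sW e1 e2 a1 a2.
exact: kstrong_separated sW e2 e1 a2 a1.
Qed.

Lemma ncrossS s W W' A : W \subset W' -> (ncross s W A <= ncross s W' A)%N.
Proof.
move=> /subsetP WW'; apply: sub_count => e /andP[/andP[e1 e2] ->].
by rewrite /inside !WW'.
Qed.

Lemma kstrong_leq s j k W : (j <= k)%N -> kstrong s k W -> kstrong s j W.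
Proof.
move=> jk /forallP sW; apply/forallP => A; apply/implyP => cutA.
by apply: leq_trans jk _; have /implyP := sW A; apply.
Qed.

Lemma kstrong_take s i k W : kstrong (take i s) k W -> kstrong s k W.
Proof.
move=> /forallP sW; apply/forallP => A; apply/implyP => cutA.
have /implyP/(_ cutA)/leq_trans := sW A; apply.
by rewrite /ncross -[in X in (_ <= X)%N](cat_take_drop i s) count_cat leq_addr.
Qed.

Lemma kstrong0 s W : kstrong s 0 W.
Proof. by apply/forallP => A; apply/implyP. Qed.

Lemma strengthP s e : exists2 W, kstrong s (strength s e) W & inside W e.
Proof.
pose P (k : 'I_(size s).+1) := [exists W, kstrong s k W && inside W e].
have P0 : (0 < #|P|)%N.
  apply/card_gt0P; exists ord0; apply/existsP; exists [set: V].
  by rewrite kstrong0 /inside !inE.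
have [k /existsP[W /andP[sW eW]] strE] := eq_bigmax_cond (@nat_of_ord _) P0.
by exists W => //; rewrite /strength strE.
Qed.

Lemma strength_le_size s e : (strength s e <= size s)%N.
Proof. by apply/bigmax_leqP => k _; rewrite -ltnS. Qed.

Lemma kstrong_le_strength s e k W : e.1 != e.2 -> kstrong s k W ->
  inside W e -> (k <= strength s e)%N.
Proof.
move=> ne sW eW.
have ks : (k < (size s).+1)%N.
  have /(kstrong_crossed sW eW) ke : crosses [set e.1] e.
    by rewrite /crosses !inE eqxx [e.2 == _]eq_sym (negPf ne).
  exact: leq_trans ke (count_size _ _).
apply: (@leq_bigmax_cond _ _ _ (Ordinal ks)).
by apply/existsP; exists W; rewrite sW.
Qed.

Lemma strength_take s i e : e.1 != e.2 ->
  (strength (take i s) e <= strength s e)%N.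
Proof.
move=> ne; have [W sW eW] := strengthP (take i s) e.
by apply: kstrong_le_strength ne _ eW; apply: kstrong_take sW.
Qed.

Lemma strength_gt0 s e : e \in s -> e.1 != e.2 -> (0 < strength s e)%N.
Proof.
move=> es ne; apply: (@kstrong_le_strength _ _ _ [set e.1; e.2]) => //; last first.
  by rewrite /inside !inE !eqxx orbT.
apply/forallP => A; apply/implyP => /andP[/set0Pn[z zA] /properP[sub [y yW yA]]].
rewrite -has_count; apply/hasP; exists e => //.
rewrite /inside !inE !eqxx orbT /=.
have := subsetP sub z zA; rewrite /crosses.
move: yW; rewrite !inE => /orP[] /eqP E1 /orP[] /eqP E2; subst.
- by rewrite zA in yA.
- by rewrite zA (negPf yA).
- by rewrite zA (negPf yA).
- by rewrite zA in yA.
Qed.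

(* Following the side of a small cut that contains [e] produces a chain of at
   most [#|V|] cuts, one of which splits any given set containing [e]. *)
Lemma separating_cuts s e : e.1 != e.2 ->
  exists fam : seq ({set V} * {set V}), [/\ (size fam <= #|V|)%N,
    forall c, c \in fam -> (ncross s c.1 c.2 <= strength s e)%N,
    forall c x, c \in fam -> inside c.1 x -> crosses c.2 x ->
      (strength s x <= strength s e)%N &
    forall W, inside W e ->
      exists2 c, c \in fam & (W \subset c.1) && is_cut W (W :&: c.2)].
Proof.
move=> ne; set k := strength s e.
(* Generalised to sets [S] that contain every [k.+1]-strong set they meet, the invariant of the
   descent. *)
suff main : forall S, inside S e ->
    (forall U z, kstrong s k.+1 U -> z \in U -> z \in S -> U \subset S) ->
  exists fam : seq ({set V} * {set V}), [/\ (size fam <= #|S|)%N,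
    forall c, c \in fam -> (ncross s c.1 c.2 <= k)%N,
    forall c x, c \in fam -> inside c.1 x -> crosses c.2 x ->
      (strength s x <= k)%N &
    forall W, inside W e -> W \subset S ->
      exists2 c, c \in fam & (W \subset c.1) && is_cut W (W :&: c.2)].
  have [||fam [f1 f2 f3 f4]] := main [set: V].
  - by rewrite /inside !inE.
  - by move=> *; apply: subsetT.
  exists fam; split => //; first by rewrite -cardsT.
  by move=> W We; apply: f4 => //; apply: subsetT.
move=> S; have [n] := ubnP #|S|; elim: n S => // n IH S Sn Se Sclosed.
have : ~~ kstrong s k.+1 S.
  by apply/negP => sS; have := kstrong_le_strength ne sS Se; rewrite ltnn.
rewrite negb_forall => /existsP[A]; rewrite negb_imply -leqNgt.
case/andP=> cutA Ak.
(* A stronger edge would lie in a [k.+1]-strong set inside [S], which [A] would split by more than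
   [k] edges. *)
have Across x : inside S x -> crosses A x -> (strength s x <= k)%N.
  move=> /andP[x1 x2] Ax; rewrite leqNgt; apply/negP => kx.
  have [U sU Ux] := strengthP s x.
  have {}sU := kstrong_leq kx sU.
  have US : U \subset S by apply: Sclosed sU _ x1; case/andP: Ux.
  have := leq_trans (kstrong_crossed sU Ux Ax) (leq_trans (ncrossS _ _ US) Ak).
  by rewrite ltnn.
pose A' := if e.1 \in A then A else S :\: A.
have A'A z : z \in S -> (z \in A') = ((z \in A) == (e.1 \in A)).
  move=> zS; rewrite /A'; case: ifP => _;
    by rewrite ?inE ?zS ?eqb_id ?eqbF_neg ?andbT.
have AS : A \proper S by case/andP: cutA.
have A'S : A' \proper S.
  rewrite /A'; case: ifP => // _; rewrite properE subsetDl /=.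
  case/andP: cutA => /set0Pn[z zA] _; apply/subsetPn; exists z.
    exact: (subsetP (proper_sub AS)).
  by rewrite inE zA.
have split_W W : inside W e -> W \subset S -> ~~ (W \subset A') ->
    is_cut W (W :&: A).
  move=> /andP[e1 e2] WS /subsetPn[z zW]; rewrite A'A ?(subsetP WS) //.
  case: (boolP (z \in A)) => zA; case: (boolP (e.1 \in A)) => eA // _.
    exact: is_cut_setI zW e1 zA eA.
  exact: is_cut_setI e1 zW eA zA.
(* If [A] splits [e], it splits every set containing [e] and the chain ends; otherwise the descent
   continues in [A'], the side holding [e]. *)
have [Ae|Ae] := boolP (crosses A e).
  exists [:: (S, A)]; split.
  - by rewrite /= card_gt0; apply/set0Pn; exists e.1; case/andP: Se.
  - by move=> c; rewrite inE => /eqP ->.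
  - by move=> c x; rewrite inE => /eqP ->; apply: Across.
  - move=> W We WS; exists (S, A); rewrite ?mem_head //= WS split_W //.
    apply/subsetPn; exists e.2; first by case/andP: We.
    rewrite A'A; last by case/andP: Se.
    by rewrite eq_sym; move: Ae; rewrite /crosses.
have A'e : inside A' e.
  case/andP: (Se) => e1 e2; rewrite /inside !A'A // eqxx /=.
  by move: Ae; rewrite /crosses negbK eq_sym.
have cardA' : (#|A'| < #|S|)%N := proper_card A'S.
have [||fam [f1 f2 f3 f4]] := IH A' _ A'e.
- exact: leq_trans cardA' _.
- move=> U z sU zU zA'.
  have zS := subsetP (proper_sub A'S) _ zA'.
  have US := Sclosed _ _ sU zU zS.
  apply/subsetP => w wU; apply: contraT => wA'.
  suff : (k.+1 <= ncross s U A)%N.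
    move=> kU; have := leq_trans kU (leq_trans (ncrossS _ _ US) Ak).
    by rewrite ltnn.
  move: zA' wA'; rewrite !A'A ?(subsetP US) //.
  case: (boolP (z \in A)); case: (boolP (w \in A)); case: (e.1 \in A) => // wA zA _ _.
    exact: kstrong_separated sU zU wU zA wA.
  exact: kstrong_separated sU wU zU wA zA.
exists ((S, A) :: fam); split.
- exact: leq_ltn_trans f1 cardA'.
- by move=> c; rewrite inE => /orP[/eqP -> //|/f2].
- by move=> c x; rewrite inE => /orP[/eqP ->|/f3]; [apply: Across|apply].
- move=> W We WS; have [WA'|WA'] := boolP (W \subset A').
    have [c cf cW] := f4 W We WA'.
    by exists c; rewrite // inE cf orbT.
  by exists (S, A); rewrite ?mem_head //= WS split_W.
Qed.

(** * Strong components and the decomposition of cut values by level *)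

Definition component s k v : {set V} :=
  \bigcup_(W : {set V} | kstrong s k W && (v \in W)) W.

Lemma component_max s k v W : kstrong s k W -> v \in W ->
  W \subset component s k v.
Proof. by move=> sW vW; apply: bigcup_sup; rewrite sW. Qed.

Lemma mem_component s k v : v \in component s k v.
Proof.
have s1 : kstrong s k [set v].
  by apply/forallP => A; apply/implyP => /card_cut; rewrite cards1.
by apply: (subsetP (component_max s1 _)); rewrite inE.
Qed.

(** Any cut of the union separates [v] from some [w], hence splits the [k]-strong set that joins
    them. *)
Lemma kstrong_component s k v : kstrong s k (component s k v).
Proof.
apply/forallP => A; apply/implyP => /andP[/set0Pn[y yA] /properP[sub [z zU zA]]].
have yU := subsetP sub y yA.
have key w : w \in component s k v -> (w \in A) != (v \in A) ->
    (k <= ncross s (component s k v) A)%N.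
  move=> /bigcupP[W /andP[sW vW] wW] ne.
  apply: leq_trans (ncrossS s A (component_max sW vW)).
  move: ne; case: (boolP (w \in A)); case: (boolP (v \in A)) => // vA wA _.
    exact: kstrong_separated sW wW vW wA vA.
  exact: kstrong_separated sW vW wW vA wA.
have [vA|vA] := boolP (v \in A).
  by apply: (key z) => //; rewrite (negPf zA) vA.
by apply: (key y) => //; rewrite yA (negPf vA).
Qed.

Lemma component_eq s k v w : w \in component s k v ->
  component s k w = component s k v.
Proof.
move=> wv; have sub1 := component_max (kstrong_component s k v) wv.
apply/eqP; rewrite eqEsubset sub1 andbT.
exact: component_max (kstrong_component s k w) (subsetP sub1 _ (mem_component _ _ _)).
Qed.

Lemma leq_strength s k e : e.1 != e.2 ->
  (k <= strength s e)%N = (e.2 \in component s k e.1).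
Proof.
move=> ne; apply/idP/idP => [ke|e2].
  have [W sW /andP[e1 e2]] := strengthP s e.
  exact: (subsetP (component_max (kstrong_leq ke sW) e1)).
apply: (kstrong_le_strength ne (kstrong_component s k e.1)).
by rewrite /inside mem_component.
Qed.

Variable R : realType.

(* Among the edges of the cut, the [k']-strong component of one of maximal
   strength [k'] is split by at least [k'] edges, all of strength [k']. *)
Lemma component_cut_weight s k v A : (forall e, e \in s -> e.1 != e.2) ->
  (0 < k)%N -> is_cut (component s k v) A ->
  1 <= \sum_(x <- s | inside (component s k v) x && crosses A x)
         (strength s x)%:R^-1 :> R.
Proof.
move=> snl k0 cutA; set U := component s k v in cutA *.
have sU : kstrong s k U := kstrong_component s k v.
have : (0 < ncross s U A)%N.
  by apply: leq_trans k0 _; have /forallP/(_ A)/implyP := sU; apply.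
rewrite -has_count => /hasP[x0 x0s x0P].
pose P x := [&& x \in s, inside U x & crosses A x].
have Px0 : P x0 by rewrite /P x0s.
have [y /and3P[ys yU yA] ymax] := @arg_maxnP _ x0 P (strength s) Px0.
set k' := strength s y in ymax.
have k'0 : (0 < k')%N by apply: strength_gt0 => //; apply: snl.
have kk' : (k <= k')%N by apply: kstrong_le_strength (snl _ ys) sU yU.
have [U' sU' yU'] := strengthP s y; rewrite -/k' in sU'.
have U'U : U' \subset U.
  case/andP: (yU) => y1 _; rewrite /U -(component_eq y1).
  by apply: component_max (kstrong_leq kk' sU') _; case/andP: yU'.
apply: (@le_trans _ _ (\sum_(x <- s | inside U' x && crosses A x) k'%:R^-1)).
  rewrite big_const_seq iter_addr_0 -[leRHS]mulr_natl.
  rewrite ler_pdivlMr ?ltr0n // mul1r ler_nat.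
  exact: kstrong_crossed sU' yU' yA.
rewrite big_mkcond [leRHS]big_mkcond big_seq [leRHS]big_seq; apply: ler_sum => x xs.
case: ifP => [/andP[xU' xA]|_]; last by case: ifP; rewrite // invr_ge0.
have xU : inside U x.
  by case/andP: xU' => x1 x2; rewrite /inside !(subsetP U'U).
rewrite xU xA /= lef_pV2 ?posrE ?ltr0n ?strength_gt0 ?snl //.
by rewrite ler_nat; apply: ymax; rewrite /P xs xU.
Qed.

Definition components s k : {set {set V}} := [set component s k v | v : V].

Definition cut_weight s U A x : R :=
  (inside U x && crosses A x)%:R / (strength s x)%:R.

(** The edge lies inside exactly one component at each level up to its strength and inside none
    above, so the reciprocal of the strength is added as often as the strength says. Index [k]
    stands for level [k.+1]. *)
Lemma cut_weight_sum s C x : x \in s -> x.1 != x.2 ->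
  \sum_(k < size s) \sum_(U in components s k.+1) cut_weight s U (U :&: C) x =
  (crosses C x)%:R.
Proof.
move=> xs nx.
have inner k : \sum_(U in components s k.+1) cut_weight s U (U :&: C) x =
    if (k < strength s x)%N then (crosses C x)%:R / (strength s x)%:R else 0.
  have compx : component s k.+1 x.1 \in components s k.+1 by apply: imset_f.
  rewrite (bigD1 (component s k.+1 x.1)) //= big1 ?addr0.
    rewrite leq_strength // /cut_weight.
    have [x2|x2] := boolP (x.2 \in _); last first.
      by rewrite /inside (negPf x2) andbF mul0r.
    have xU : inside (component s k.+1 x.1) x by rewrite /inside mem_component.
    by rewrite xU crosses_setI.
  move=> U /andP[/imsetP[v _ ->] ne]; rewrite /cut_weight /inside.
  have [x1|_] := boolP (x.1 \in _); last by rewrite mul0r.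
  by rewrite (component_eq x1) eqxx in ne.
under eq_bigr do rewrite inner.
rewrite -big_mkcond /= -(big_ord_widen _ (fun=> _)); last exact: strength_le_size.
rewrite sumr_const card_ord -[LHS]mulr_natr mulfVK // pnatr_eq0 -lt0n.
exact: strength_gt0.
Qed.

Lemma VAL_decomposition s C (H : wgraph R V) :
  (forall e, e \in s -> e.1 != e.2) ->
  all (fun y => y.1 \in s) H ->
  VAL C H = \sum_(k < size s) \sum_(U in components s k.+1)
    wsum (cut_weight s U (U :&: C)) H.
Proof.
move=> snl /allP Hs.
rewrite /wsum; under eq_bigr do rewrite exchange_big /=.
rewrite exchange_big /= /VAL big_mkcond big_seq [RHS]big_seq.
apply: eq_bigr => x /Hs xs.
under eq_bigr do rewrite -mulr_suml.
rewrite -mulr_suml cut_weight_sum //; last exact: snl.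
by case: (crosses _ _); rewrite ?mul1r ?mul0r.
Qed.

End Strength.

Lemma ler_sum_term (R : realType) (I : eqType) (r : seq I) (P : pred I)
    (F : I -> R) (i : I) : i \in r -> P i -> (forall j, P j -> 0 <= F j) ->
  F i <= \sum_(j <- r | P j) F j.
Proof.
move=> ir Pi F0; rewrite (big_rem i ir) /= Pi lerDl.
by apply: sumr_ge0 => j /F0.
Qed.

(** * Union bounds *)

Section Sparsification.
Variables (R : realType) (V : finType) (s : seq (edge V)) (e0 : edge V).
Variables (eps X : R).
Hypotheses (eps_gt0 : 0 < eps) (eps_lt : eps < 2^-1).
Hypothesis X_gt0 : 0 < X.
Hypothesis s_loopless : forall e, e \in s -> e.1 != e.2.
Let rho : R := 32 * X * (1 + eps) / eps ^+ 2.

Let eps1_gt0 : 0 < 1 + eps. Proof. by rewrite addr_gt0. Qed.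

Let rho_gt0 : 0 < rho.
Proof. by rewrite divr_gt0 ?exprn_gt0 // !mulr_gt0. Qed.

(** Each edge carries its killing threshold. The prefix [take i.+1 s] includes the arriving edge, so
    its strength there is positive. *)
Definition bounded_stream : seq (edge V * R) :=
  mkseq (fun i => (nth e0 s i,
    (1 + eps) * (strength (take i.+1 s) (nth e0 s i))%:R)) (size s).

Lemma bounded_stream_fst i : [seq x.1 | x <- take i bounded_stream] = take i s.
Proof.
rewrite map_take /bounded_stream /mkseq -map_comp; congr (take i _).
exact: mkseq_nth.
Qed.

Lemma mem_bounded_stream i x : x \in take i bounded_stream ->
  exists2 j, (j < i)%N && (j < size s)%N &
    x = (nth e0 s j, (1 + eps) * (strength (take j.+1 s) (nth e0 s j))%:R).
Proof.
rewrite /bounded_stream /mkseq -map_take take_iota => /mapP[j].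
by rewrite mem_iota /= add0n leq_min => ji ->; exists j.
Qed.

Lemma strongly_connected_le (H : wgraph R V) (k : R) (W S A : {set V}) :
  all (fun x => 0 <= x.2) H ->
  strongly_connected H k W -> W \subset S -> is_cut W (W :&: A) ->
  k <= wsum (fun x => (inside S x && crosses A x)%:R) H.
Proof.
move=> /allP H0 /forallP/(_ (W :&: A))/implyP sW WS /sW/le_trans; apply.
rewrite /VAL /induced big_filter_cond /wsum big_mkcond big_seq [leRHS]big_seq.
apply: ler_sum => x /H0 x0; case: ifP => [/andP[xW]|_]; last by rewrite mulr_ge0.
rewrite (crosses_setI _ xW) => ->.
case/andP: xW => x1 x2.
by rewrite /inside !(subsetP WS) // mul1r.
Qed.

Lemma sum_indicator (t : seq (edge V)) (P : pred (edge V)) :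
  \sum_(x <- t) (P x)%:R = (count P t)%:R :> R.
Proof.
rewrite -sum1_count natr_sum [RHS]big_mkcond.
by apply: eq_bigr => x _; case: (P x).
Qed.

(** A set witnessing too large a strong connectivity is split by a cut of [separating_cuts], which
    has at most [k] edges in the prefix; the sampled weight of that cut must then exceed its mean by
    more than [eps * k]. *)
Lemma overestimate_prob i : (i < size s)%N ->
  let x := nth (e0, 0) bounded_stream i in
  expect_killed rho (take i bounded_stream)
    (fun H => (~~ (strong_connectivity H x.1 <= x.2))%:R) [::] <=
  #|V|%:R * expR (- (8 * X)).
Proof.
move=> im; rewrite nth_mkseq //=; set e := nth e0 s i.
set s' := take i.+1 s; set k := strength s' e.
have es : e \in s by rewrite mem_nth.
have ne : e.1 != e.2 := s_loopless es.
have es' : e \in s'.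
  by rewrite /s' (take_nth e0) // mem_rcons mem_head.
have k0 : 0 < k%:R :> R by rewrite ltr0n strength_gt0.
have [fam [f1 f2 f3 f4]] := separating_cuts s' ne.
pose a (c : {set V} * {set V}) x : R := (inside c.1 x && crosses c.2 x)%:R.
pose S c : R := (ncross (take i s) c.1 c.2)%:R.
have Sk c : c \in fam -> S c <= k%:R.
  move=> cf; rewrite ler_nat; apply: leq_trans (f2 _ cf).
  by rewrite /s' (take_nth e0) // /ncross -cats1 count_cat leq_addr.
pose dev c H : R := (eps * k%:R < (-1) ^+ false * (wsum (a c) H - S c))%R%:R.
apply: (@le_trans _ _ (expect_killed rho (take i bounded_stream)
    (fun H => \sum_(c <- fam | c \in fam) dev c H) [::])).
  apply: (@expect_killed_le _ _ _ rho_gt0 predT) => //; first by elim: take.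
  move=> H suppH; have H0 : all (fun x => 0 <= x.2) H by [].
  have [allc|] := boolP (all (fun c => dev c H == 0) fam); last first.
    case/allPn => c cf; rewrite /dev; case: ltP => [big|]; last by rewrite eqxx.
    move=> _; apply: (@le_trans _ _ 1); first by case: (~~ _).
    apply: (@le_trans _ _ (dev c H)); first by rewrite /dev big.
    by apply: (ler_sum_term (F := fun c => dev c H)).
  suff -> : strong_connectivity H e <= (1 + eps) * k%:R by apply: sumr_ge0.
  apply: strong_connectivity_le; first by rewrite mulr_ge0 // ltW.
  move=> j W sW We; have [c cf /andP[Wc cW]] := f4 W We.
  apply: le_trans (strongly_connected_le H0 sW Wc cW) _.
  have := allP allc c cf; rewrite /dev expr0 mul1r.
  case: ltP => [_|le_dev _]; first by rewrite oner_eq0.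
  by move: le_dev (Sk c cf); rewrite -/(a c); lra.
rewrite expect_killed_sum.
apply: (@le_trans _ _ (\sum_(c <- fam | c \in fam) expR (- (8 * X)))); last first.
  rewrite big_const_seq iter_addr_0 -[leLHS]mulr_natl.
  rewrite ler_wpM2r ?expR_ge0 // ler_nat.
  exact: leq_trans (count_size _ _) f1.
apply: ler_sum => c cf.
(* The increment bound is [M = (1 + eps) * k / rho]; the constant 32 in [rho] yields the exponent
   [8 * X]. *)
have -> : 8 * X = eps ^+ 2 * k%:R / (4 * ((1 + eps) * k%:R / rho)).
  by rewrite /rho; field; rewrite !gt_eqF.
apply: expect_killed_tail => //.
- by rewrite divr_gt0 // mulr_gt0.
- exact: ltW.
- exact: ltW.
(* An earlier edge across the cut has strength at most [k] in [s'], hence also in its own shorter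
   prefix. *)
- move=> x /mem_bounded_stream[j /andP[ji jm] ->] /=.
  split; first by rewrite ler0n.
  rewrite mulfVK ?gt_eqF // /a; case: (boolP (_ && _)) => [/andP[xc cx]|_].
    rewrite mul1r (ler_wpM2l (ltW eps1_gt0)) // ler_nat.
    apply: leq_trans (f3 _ _ cf xc cx).
    have -> : take j.+1 s = take j.+1 s' by rewrite take_takel // ltnS ltnW.
    by apply: strength_take; apply: s_loopless; rewrite mem_nth.
  by rewrite mul0r mulr_ge0 // ltW.
- rewrite -(big_map fst predT (a c)) bounded_stream_fst.
  by rewrite /a sum_indicator.
- exact: Sk.
Qed.

(** * Deviations of the component cuts in the final graph *)

Definition deviates U A (b : bool) (H : wgraph R V) : bool :=
  let S := \sum_(x <- s) cut_weight R s U A x in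
  eps * S < (-1) ^+ b * (wsum (cut_weight R s U A) H - S).

(** Errors of the pieces in [VAL_decomposition] add up by the triangle inequality, and the allowed
    errors add up to [eps] times the cut value of the stream. *)
Lemma approximates_of_components (H : wgraph R V) :
  all (fun x => x.1 \in s) H ->
  (forall k U A b, (k < size s)%N -> U \in components s k.+1 -> is_cut U A ->
    ~~ deviates U A b H) ->
  approximates eps (unit_graph R s) H.
Proof.
move=> Hs good; apply/forallP => C; apply/implyP => _.
have Gs : all (fun x => x.1 \in s) (unit_graph R s).
  by apply/allP => _ /mapP[x xs ->].
suff : `|VAL C H - VAL C (unit_graph R s)| <= eps * VAL C (unit_graph R s).
  by rewrite ler_norml => /andP[? ?]; apply/andP; split; lra.
rewrite !(VAL_decomposition C s_loopless) // -sumrB mulr_sumr.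
apply: le_trans (ler_norm_sum _ _ _) _; apply: ler_sum => k _.
rewrite -sumrB mulr_sumr.
apply: le_trans (ler_norm_sum _ _ _) _; apply: ler_sum => U Uk.
have SE a : wsum a (unit_graph R s) = \sum_(x <- s) a x.
  by rewrite /wsum big_map; apply: eq_bigr => x _; rewrite mulr1.
rewrite SE.
have [cutC|ncutC] := boolP (is_cut U (U :&: C)).
  have := good k U _ false (ltn_ord k) Uk cutC.
  have := good k U _ true (ltn_ord k) Uk cutC.
  by rewrite /deviates -!leNgt expr0 expr1 ler_norml; lra.
(* When [C] does not split [U], no edge inside [U] crosses and the piece vanishes. *)
have cw0 x : cut_weight R s U (U :&: C) x = 0.
  rewrite /cut_weight; case: (boolP (_ && _)) => [/andP[/andP[x1 x2]]|_];
    last by rewrite mul0r.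
  rewrite crosses_setI /inside ?x1 // => /crossesP[[y1 y2]|[y1 y2]].
    by rewrite (is_cut_setI x1 x2 y1 y2) in ncutC.
  by rewrite (is_cut_setI x2 x1 y2 y1) in ncutC.
rewrite /wsum !big1 ?subr0 ?normr0 ?mulr0 // => x _; by rewrite cw0 ?mul0r.
Qed.

(** Strengths only grow along the stream, so weight times threshold is at most [1 + eps] and
    [M = (1 + eps) / rho] gives failure [expR (- (8 * X * L))]. As [L >= 1] and [X >= ln #|U|], this
    splits into a factor [expR (- X)] for the later union bounds and the summand of
    [cut_counting]. *)
Lemma deviates_prob k U A b : (0 < k)%N -> U \in components s k -> is_cut U A ->
  ln #|V|%:R <= X ->
  expect_killed rho bounded_stream (fun H => (deviates U A b H)%:R) [::] <=
  expR (- X) * expR (- (4 * (\sum_(x <- s) cut_weight R s U A x) * ln #|U|%:R)).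
Proof.
move=> k0 /imsetP[v _ ->] cutA nX; set U' := component s k v in cutA *.
set L := \sum_(x <- s) _.
have L1 : 1 <= L.
  apply: le_trans (component_cut_weight R s_loopless k0 cutA) _.
  rewrite big_mkcond; apply: ler_sum => x _; rewrite /cut_weight.
  by case: (_ && _); rewrite ?mul1r ?mul0r.
have UX : ln #|U'|%:R <= X.
  apply: le_trans nX; have U0 := card_cut cutA.
  rewrite ler_ln ?posrE ?ltr0n ?ler_nat ?max_card //; first exact: ltnW.
  exact: leq_trans (ltnW U0) (max_card _).
apply: (@le_trans _ _ (expR (- (eps ^+ 2 * L / (4 * ((1 + eps) / rho)))))).
  rewrite -(take_size bounded_stream); apply: expect_killed_tail => //.
  - by rewrite divr_gt0.
  - exact: ltW.
  - exact: ltW.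
  - move=> x /mem_bounded_stream[j /andP[_ jm] ->] /=.
    have xs : nth e0 s j \in s by rewrite mem_nth.
    rewrite /cut_weight divfK ?gt_eqF //.
    case: (_ && _); last by rewrite !mul0r; split=> //; apply: ltW.
    split; first by rewrite divr_ge0.
    rewrite mul1r mulrCA ler_piMr // ?(ltW eps1_gt0) //.
    rewrite mulrC ler_pdivrMr ?ltr0n ?strength_gt0 ?s_loopless // mul1r ler_nat.
    by rewrite strength_take ?s_loopless.
  - by rewrite -(big_map fst predT (cut_weight R s U' A)) bounded_stream_fst
      take_oversize // size_mkseq.
have -> : eps ^+ 2 * L / (4 * ((1 + eps) / rho)) = 8 * X * L.
  by rewrite /rho; field; rewrite !gt_eqF.
rewrite -expRD ler_expR -opprD lerN2.
have : 0 <= (L - 1) * X by rewrite mulr_ge0 ?subr_ge0 // ltW.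
have : 0 <= L * (X - ln #|U'|%:R) by rewrite mulr_ge0 ?subr_ge0 //; lra.
move: (ln _) X_gt0 => lnU; nra.
Qed.

(** [cut_counting] applies to the edges inside [U] weighted by inverse strength, whose cuts weigh at
    least 1 by [component_cut_weight]; the factor 2 counts both tails. *)
Lemma sum_deviates_prob k U : (0 < k)%N -> U \in components s k ->
  ln #|V|%:R <= X ->
  \sum_(A | is_cut U A) \sum_(b : bool)
    expect_killed rho bounded_stream (fun H => (deviates U A b H)%:R) [::] <=
  2 * #|V|%:R * expR (- X).
Proof.
move=> k0 Uk nX.
pose K : wgraph R V := [seq (x, (strength s x)%:R^-1) | x <- s & inside U x].
have KE A : VAL A K = \sum_(x <- s) cut_weight R s U A x.
  rewrite /VAL /K big_map big_filter_cond big_mkcond; apply: eq_bigr => x _.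
  by rewrite /cut_weight /=; case: (_ && _); rewrite ?mul1r ?mul0r.
have count_le := @cut_counting R V K U.
apply: (@le_trans _ _ (\sum_(A | is_cut U A)
    2 * expR (- X) * expR (- (4 * VAL A K * ln #|U|%:R)))).
  apply: ler_sum => A cutA; rewrite big_bool -mulrA mulr_natl mulr2n.
  by rewrite KE lerD // (deviates_prob _ k0).
rewrite -mulr_sumr [leRHS]mulrAC ler_wpM2l ?mulr_ge0 ?expR_ge0 //.
apply: le_trans (count_le _ _) _.
- apply/allP => z /mapP[x]; rewrite mem_filter => /andP[xU xs] ->.
  by rewrite xU invr_ge0 ler0n.
- move: Uk => /imsetP[v _ UE] A cutA; rewrite KE.
  have := cutA; rewrite UE => /(component_cut_weight R s_loopless k0).
  rewrite -UE big_mkcond => /le_trans; apply; apply: ler_sum => x _.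
  by rewrite /cut_weight; case: (_ && _); rewrite ?mul1r ?mul0r.
- by rewrite ler_nat max_card.
Qed.

(** Union bound over [size s] levels with at most [#|V|] components each. *)
Lemma killed_failure_prob : ln #|V|%:R <= X ->
  expect_killed rho bounded_stream
    (fun H => (~~ approximates eps (unit_graph R s) H)%:R) [::]
  <= (size s)%:R * (#|V|%:R * (2 * #|V|%:R * expR (- X))).
Proof.
move=> nX.
pose F H : R := \sum_(k < size s) \sum_(U in components s k.+1)
  \sum_(A | is_cut U A) \sum_(b : bool) (deviates U A b H)%:R.
apply: (@le_trans _ _ (expect_killed rho bounded_stream F [::])).
  apply: (@expect_killed_le _ _ _ rho_gt0 (mem s)) => //.
    apply/allP => x; rewrite -(take_size bounded_stream).
    by move=> /mem_bounded_stream[j /andP[_ jm] ->]; rewrite /= mem_nth.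
  move=> H suppH.
  have Hs : all (fun x => x.1 \in s) H by apply: sub_all suppH => x /andP[].
  have [ge1|lt1] := leP 1 (F H); first by apply: le_trans ge1; case: (~~ _).
  rewrite approximates_of_components //; first by do 4 (apply: sumr_ge0 => ? _).
  move=> k U A b km Uk cutA; apply/negP => dev.
  move: lt1; rewrite ltNge => /negP; apply.
  have {1}-> : 1 = (deviates U A b H)%:R :> R by rewrite dev.
  rewrite /F.
  apply: (le_trans _ (ler_sum_term (i := Ordinal km) (P := predT)
    (F := fun k : 'I_(size s) => \sum_(U in components s k.+1)
      \sum_(A | is_cut U A) \sum_(b : bool) (deviates U A b H)%:R)
    (mem_index_enum _) isT _)); last by move=> ? _; do 3 (apply: sumr_ge0 => ? _).
  apply: (le_trans _ (ler_sum_term (i := U) (P := mem (components s k.+1))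
    (F := fun U => \sum_(A | is_cut U A) \sum_(b : bool) (deviates U A b H)%:R)
    (mem_index_enum _) Uk _)); last by move=> ? _; do 2 (apply: sumr_ge0 => ? _).
  apply: (le_trans _ (ler_sum_term (i := A) (P := is_cut U)
    (F := fun A => \sum_(b : bool) (deviates U A b H)%:R)
    (mem_index_enum _) cutA _)); last by move=> ? _; apply: sumr_ge0.
  exact: (ler_sum_term (i := b) (P := predT)
    (F := fun b => (deviates U A b H)%:R) (mem_index_enum _) isT).
rewrite expect_killed_sum.
apply: (@le_trans _ _ (\sum_(k < size s)
    #|V|%:R * (2 * #|V|%:R * expR (- X)))); last first.
  by rewrite sumr_const card_ord -[leLHS]mulr_natl.
apply: ler_sum => k _; rewrite expect_killed_sum.
apply: (@le_trans _ _ (\sum_(U in components s k.+1)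
    (2 * #|V|%:R * expR (- X)))); last first.
  rewrite sumr_const -[leLHS]mulr_natl ler_wpM2r ?mulr_ge0 ?expR_ge0 // ler_nat.
  exact: leq_trans (leq_imset_card _ _) (max_card _).
apply: ler_sum => U Uk; apply: le_trans (sum_deviates_prob _ Uk nX) => //.
by rewrite expect_killed_sum; apply: ler_sum => A _; rewrite expect_killed_sum.
Qed.

(** Of the constant 3, two parts bound failure of a surviving run and one bounds the chance of being
    killed. *)
Lemma sparsification_success : ln #|V|%:R <= X -> (0 < #|V|)%N ->
  1 - 3 * ((size s)%:R * #|V|%:R ^+ 2 * expR (- X)) <=
  Pr (stream_sparsification rho s)
    (fun H => approximates eps (unit_graph R s) H).
Proof.
move=> nX n0.
rewrite Pr_expect expect_stream.
set good := (fun H => _).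
pose bad H : R := (~~ approximates eps (unit_graph R s) H)%:R.
have total : 1 <= expect_run rho s good [::] + expect_run rho s bad [::].
  rewrite -expect_run_add -{1}(expect_run_cst rho s 1 [::]).
  apply: expect_run_le => // H.
  by rewrite /good /bad; case: approximates; rewrite ?addr0 ?add0r.
rewrite lerBlDr; apply: le_trans total _; rewrite lerD2l.
have bad01 H : 0 <= bad H <= 1.
  by rewrite /bad; case: approximates; rewrite /= ?lexx ?ler01.
have := @expect_run_killed _ _ _ rho_gt0 (e0, 0) bounded_stream bad [::] bad01.
rewrite -[X in [seq _ | _ <- X]](take_size bounded_stream) bounded_stream_fst.
rewrite take_oversize ?size_mkseq // => /le_trans; apply.
have := killed_failure_prob nX; rewrite -/bad => kill.
have over : \sum_(i < size s) expect_killed rho (take i bounded_stream)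
    (fun H => (~~ (strong_connectivity H (nth (e0, 0) bounded_stream i).1 <=
      (nth (e0, 0) bounded_stream i).2))%:R) [::] <=
    (size s)%:R * (#|V|%:R * expR (- (8 * X))).
  rewrite [leRHS]mulr_natl -[in X in _ *+ X](card_ord (size s)) -sumr_const.
  apply: ler_sum => i _; exact: overestimate_prob.
have expX : expR (- (8 * X)) <= expR (- X).
  by rewrite ler_expR lerN2 ler_peMl ?ltW // ltr1n.
have V1 : 1 <= #|V|%:R :> R by rewrite ler1n.
apply: le_trans (lerD kill over) _.
have le2 : (size s)%:R * (#|V|%:R * expR (- (8 * X))) <=
    (size s)%:R * (#|V|%:R ^+ 2 * expR (- X)).
  rewrite ler_wpM2l // ler_pM ?expR_ge0 // expr2 ler_peMr //.
apply: le_trans (lerD (lexx _) le2) _.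
rewrite le_eqVlt; apply/orP; left; apply/eqP; ring.
Qed.

End Sparsification.

(** * The failure probability for the given parameter *)

Unset Implicit Arguments.

Theorem theorem3 (R : realType) (d : R) (hd : 0 < d) :
  exists eps0 C : R, [/\ 0 < eps0, 0 < C &
    forall (eps : R) (V : finType) (n m : nat) (s : m.-tuple (edge V)),
      0 < eps -> eps < eps0 ->
      #|V| = n ->
      (forall e : edge V, e \in tval s -> e.1 != e.2) ->
      let rho := 32 * ((4 + d) * ln n%:R + ln m%:R) * (1 + eps) / eps ^+ 2 in
      1 - C / n%:R `^ d <=
        Pr (stream_sparsification rho s)
           (fun H => approximates eps (unit_graph R s) H)].
Proof.
(* With [eps] below 1/2, the Chernoff parameter satisfies [theta * M = eps / 2 <= 1/3] in absolute
   value. *)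
exists 2^-1, 3; split=> [||eps V n m [s /= /eqP sm] eps0 eps2 Vn snl] //.
  by rewrite invr_gt0.
case: s sm snl => [|e0 s0] sm snl.
  (* On the empty stream the output is surely empty and every cut value is 0. *)
  rewrite /Pr /stream_sparsification /= /dret big_mkcond big_seq1 /=.
  case: ifP => [_|/negP[]]; last first.
    apply/forallP => A; apply/implyP => _.
    by rewrite /unit_graph /VAL /= !big_nil !mulr0 lexx.
  by rewrite gerBl divr_ge0 // powR_ge0.
set s := e0 :: s0 in sm snl *.
(* A non-loop edge has two distinct endpoints, which makes [ln n] positive. *)
have n2 : (1 < n)%N.
  rewrite -Vn; apply/card_gt1P; exists e0.1, e0.2; split => //.
  exact: snl (mem_head _ _).
have m1 : (0 < m)%N by rewrite -sm.
have n0 : 0 < n%:R :> R by rewrite ltr0n ltnW.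
have m0 : 0 < m%:R :> R by rewrite ltr0n.
have lnn : 0 < ln n%:R :> R by rewrite ln_gt0 // ltr1n.
have lnm : 0 <= ln m%:R :> R by rewrite ln_ge0 // ler1n.
set X := (4 + d) * ln n%:R + ln m%:R.
have X0 : 0 < X by rewrite /X ltr_wpDr // mulr_gt0 // addr_gt0.
have nX : ln #|V|%:R <= X by rewrite Vn /X; nra.
have V0 : (0 < #|V|)%N by rewrite Vn ltnW.
apply: le_trans (sparsification_success e0 eps0 eps2 X0 snl nX V0).
rewrite lerD2l lerN2 ler_wpM2l // sm Vn.
(* The factor [m] cancels the number of levels and [n ^ 4] absorbs the [n ^ 2] of the union
   bounds. *)
have -> : expR (- X) = (n%:R `^ d * n%:R ^+ 4 * m%:R)^-1.
  rewrite expRN /X mulrDl [4 * _ + _]addrC !expRD lnK ?posrE // /powR gt_eqF //.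
  by rewrite expRM_natl lnK ?posrE.
have nd : 0 < n%:R `^ d by apply: powR_gt0.
have -> : m%:R * n%:R ^+ 2 * (n%:R `^ d * n%:R ^+ 4 * m%:R)^-1 =
    (n%:R `^ d)^-1 * (n%:R ^+ 2)^-1 by field; rewrite !gt_eqF.
rewrite ler_piMr ?invr_ge0 ?(ltW nd) // invf_le1 ?exprn_gt0 //.
by rewrite expr_ge1 // ler1n ltnW.
Qed.
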